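(* There exists an absolute constant $c<\infty$ such that the following holds. Consider the one-dimensional grid ($d=1$) with storage capacity $S>0$ and line capacity $C>0$, and let the net generations $Z_i(t)$ be i.i.d. $\mathcal{N}(\mu,\sigma^2)$ over $i\in\mathbb{Z}$, $t\ge0$, with $\sigma>0$. Suppose $0\le\mu\le\min(C,S)$ and $CS/\sigma^2>\max\big(\log(\sigma/\min(C,S)),\,1\big)$. Then every control scheme satisfies \[ \liminf_{n\to\infty}\epsilon_{\rm tot}(n)\ \ge\ \sigma\exp\{-c\,CS/\sigma^2\}. \]
   Context: Grid model: the vertex set is $\mathbb{Z}^d$; the edge set $E$ consists of nearest-neighbour pairs, each given a fixed orientation $e=(i,k)$. There is a storage capacity $S\ge0$ at every node and a line capacity $C>0$ on every edge. Time is $t\in\{0,1,2,\dots\}$ and $Z_i(t)$ is the net generation (production minus demand) at node $i$ in slot $t$. A control scheme is any family of real random variables $Y_i(t)$ (energy put into storage), $W_i(t)$ (fast generation; negative values mean energy drawn from backup generation, positive values mean energy dumped), $B_i(t)$ (stored energy) and $F_e(t)$ (line flows), defined on the same probability space as the $Z$'s (arbitrary dependence allowed), such that for all $i,t$: $B_i(0)=0$, $B_i(t+1)=B_i(t)+Y_i(t)$, $0\le B_i(t)\le S$, and the energy balance $Z_i(t)-Y_i(t)-W_i(t)=\sum_{e=(i,k)\in E}F_e(t)-\sum_{e=(k,i)\in E}F_e(t)$. For $n\ge1$ let $\Lambda_n=\{0,\dots,n-1\}^d$, $E_n$ the set of edges with both endpoints in $\Lambda_n$, $x_-=\max(-x,0)$,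 $x_+=\max(x,0)$, and \[ \epsilon_{\rm tot}(n)=\frac{1}{n|\Lambda_n|}\sum_{t=0}^{n-1}\sum_{i\in\Lambda_n}\mathbb{E}\big[(W_i(t))_-\big]+\frac{1}{n|E_n|}\sum_{t=0}^{n-1}\sum_{e\in E_n}\mathbb{E}\big[(F_e(t)-C)_++(-C-F_e(t))_+\big]. \] *)

(* Defs.v *)
From HB Require Import structures.
From mathcomp Require Import all_boot all_order all_algebra.
From mathcomp Require Import all_classical all_reals all_analysis.
Set Implicit Arguments. Unset Strict Implicit. Unset Printing Implicit Defensive.
Import Order.TTheory GRing.Theory Num.Theory.
Import numFieldNormedType.Exports.
Local Open Scope classical_set_scope.
Local Open Scope ring_scope.

(* One-dimensional grid: vertices are integers; the nearest-neighbour edge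
   {i, i+1} is indexed by i : int.  Its fixed orientation is given by
   [o i : bool]: if [o i] the edge is e = (i, i+1), otherwise e = (i+1, i).
   The flow F i t is the flow along the oriented edge. *)

Definition mutually_independent d (T : measurableType d) (R : realType)
    (P : probability T R) (I : eqType) (X : I -> T -> R) : Prop :=
  forall (s : seq I), uniq s ->
  forall (A : I -> set R), (forall j, measurable (A j)) ->
    P (\bigcap_(j in [set` s]) (X j @^-1` A j)) =
    (\prod_(j <- s) P (X j @^-1` A j))%E.

Definition iid_gaussian d (T : measurableType d) (R : realType)
    (P : probability T R) (m sigma : R) (Z : int -> nat -> T -> R) : Prop :=
  (forall i t, measurable_fun setT (Z i t)) /\
  (forall i t (A : set R), measurable A ->
      P (Z i t @^-1` A) = normal_prob m sigma A) /\
  mutually_independent P (fun p : int * nat => Z p.1 p.2).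

(* Energy balance at node i for the 1-d grid with orientation o:
   sum_{e=(i,k)} F_e - sum_{e=(k,i)} F_e. *)
Definition net_outflow (R : realType) (o : int -> bool) (F : int -> R) (i : int) : R :=
  (if o i then F i else - F i) + (if o (i - 1) then - F (i - 1) else F (i - 1)).

Definition control_scheme d (T : measurableType d) (R : realType)
    (o : int -> bool) (S : R) (Z Y W B F : int -> nat -> T -> R) : Prop :=
  (forall i t, measurable_fun setT (Y i t)) /\
  (forall i t, measurable_fun setT (W i t)) /\
  (forall i t, measurable_fun setT (B i t)) /\
  (forall i t, measurable_fun setT (F i t)) /\
  (forall i w, B i 0%N w = 0) /\
  (forall i t w, B i t.+1 w = B i t w + Y i t w) /\
  (forall i t w, 0 <= B i t w <= S) /\
  (forall i t w, Z i t w - Y i t w - W i t w =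
                 net_outflow o (fun e => F e t w) i).

Definition negpart (R : realType) (x : R) : R := Num.max (- x) 0.
Definition pospart (R : realType) (x : R) : R := Num.max x 0.

(* epsilon_tot(n) for d = 1: Lambda_n = {0,...,n-1}, |Lambda_n| = n;
   E_n = edges {i,i+1} with 0 <= i <= n-2, |E_n| = n-1. *)
Definition eps_tot d (T : measurableType d) (R : realType)
    (P : probability T R) (C : R) (W F : int -> nat -> T -> R) (n : nat) : \bar R :=
  (((n * n)%:R : R)^-1%:E *
     \sum_(t < n) \sum_(i < n) 'E_P[fun w => negpart (W (i : nat)%:Z t w)]
   + ((n * (n - 1))%:R : R)^-1%:E *
     \sum_(t < n) \sum_(i < n.-1)
        'E_P[fun w => (pospart (F (i : nat)%:Z t w - C) + pospart (- C - F (i : nat)%:Z t w))%R])%E.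

(* Main.v *)
Require Import Defs.
From HB Require Import structures.
From mathcomp Require Import all_boot all_order all_algebra.
From mathcomp Require Import all_classical all_reals all_analysis.
From mathcomp Require Import measurable_realfun ring lra zify.
Set Implicit Arguments. Unset Strict Implicit. Unset Printing Implicit Defensive.
Import Order.TTheory GRing.Theory Num.Theory.
Import numFieldNormedType.Exports.
Local Open Scope classical_set_scope.
Local Open Scope ring_scope.

(**
Fix a window of k consecutive nodes and l consecutive slots.  Summing the
energy balance over it, the storage can supply at most k S and the two boundary
edges at most 2 C l within capacity, so any deficit of the total net generation
beyond th = k S + 2 C l is paid by backup generation inside the window or by
overflow on its boundary.  The total net generation is normal with mean k l m
and variance s^2 = k l sigma^2, so the window pays on average at least
s P(total <= - th - s).  Taking l = 1, k ~ C / S if S <= C, and k = 1,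
l ~ S / C otherwise, makes (th + k l m)^2 / s^2 = O(C S / sigma^2), and the
hypothesis on ln (sigma / min(C, S)) makes sqrt (k l) = exp (O(C S / sigma^2)).
Averaging over all positions of the window bounds eps_tot.
*)

(** * Sums of independent normal variables *)

(** Lebesgue measure is determined by its values on half-open intervals, and translation preserves
    their lengths. *)
Lemma lebesgue_measure_translation (R : realType) (x : R) (A : set R) :
  measurable A ->
  pushforward (@lebesgue_measure R) (+%R x : _ -> measurableTypeR R) A
    = lebesgue_measure A.
Proof.
move=> mA; have mx : measurable_fun setT (+%R x : _ -> measurableTypeR R).
  exact: measurable_funD.
apply/esym.
have := @lebesgue_measure_unique R
  (pushforward (@lebesgue_measure R) (+%R x : _ -> measurableTypeR R)).
apply => //= _ [[a b]] _ <-.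
rewrite /pushforward/=.
have -> : (+%R x : R -> R) @^-1` `]a, b] = `]a - x, b - x]%classic.
  by apply/seteqP; split=> y /=; rewrite !in_itv/= ltrBlDl lerBrDl.
rewrite !lebesgue_measure_itv/= !lte_fin ltrD2r.
by case: ifP => // _; rewrite -!EFinB; congr EFin; ring.
Qed.

(** The Radon-Nikodym derivative of the normal law has the same integrals as [normal_pdf] over all
    measurable sets, so the two agree almost everywhere and may be exchanged under the integral. *)
Lemma integral_normal_prob (R : realType) (m s : R) (f : R -> \bar R) :
  measurable_fun setT f ->
  (\int[normal_prob m s]_x `|f x| < +oo)%E ->
  (\int[normal_prob m s]_x f x =
   \int[lebesgue_measure]_x (f x * (normal_pdf m s x)%:E))%E.
Proof.
move=> mf finf; have dom := normal_prob_dominates m s.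
have mpdf : measurable_fun setT (fun x => (normal_pdf m s x)%:E).
  by apply/measurable_EFinP; exact: measurable_normal_pdf.
rewrite -(Radon_Nikodym_change_of_variables dom)//=; last first.
  by apply/integrableP; split.
apply: ae_eq_integral => //.
- exact: emeasurable_funM.
- exact: emeasurable_funM.
- apply: ae_eqe_mul2l => /=.
  rewrite Radon_NikodymE//=.
  case: cid => /= h [h1 h2 h3].
  apply: integral_ae_eq => //=.
  by move=> E E01 mE; rewrite -h3.
Qed.

Local Open Scope ereal_scope.

(** Translation invariance gives the change of variable. The left side is the measure of the section
    at [x] of the event that a sum of two coordinates lies in [A], so this prepares the convolution
    formula. *)
Lemma normal_prob_shift (R : realType) (m s x : R) (A : set R) :
  measurable A ->
  normal_prob m s (+%R x @^-1` A) =
  \int[lebesgue_measure]_(y in A) (normal_pdf m s (y - x))%:E.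
Proof.
move=> mA.
have mx : measurable_fun setT (+%R x : _ -> measurableTypeR R).
  exact: measurable_funD.
have mf : measurable_fun setT (fun y : R => (normal_pdf m s (y - x))%:E).
  apply/measurable_EFinP/measurableT_comp; first exact: measurable_normal_pdf.
  exact: measurable_funB.
transitivity (\int[pushforward (@lebesgue_measure R)
    (+%R x : _ -> measurableTypeR R)]_(y in A) (normal_pdf m s (y - x))%:E).
  rewrite ge0_integral_pushforward//; last 2 first.
  - exact: measurable_funTS.
  - by move=> y _; rewrite lee_fin normal_pdf_ge0.
  by apply: eq_integral => y _ /=; rewrite (addrC x) addrK.
apply: eq_measure_integral => B mB _.
exact: lebesgue_measure_translation.
Qed.

Local Close Scope ereal_scope.

Lemma normal_peakE (R : realType) (s : R) : 0 < s ->
  normal_peak s = s^-1 * (Num.sqrt (pi *+ 2))^-1.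
Proof.
move=> s0; rewrite /normal_peak -mulrnAr sqrtrM ?sqr_ge0// sqrtr_sqr.
by rewrite gtr0_norm// invfM.
Qed.

(* Completing the square in x. *)
Lemma normal_pdf_conv (R : realType) (m1 m2 s1 s2 x y : R)
    (s := Num.sqrt (s1 ^+ 2 + s2 ^+ 2)) :
  0 < s1 -> 0 < s2 ->
  normal_pdf m1 s1 x * normal_pdf m2 s2 (y - x) =
  normal_pdf (m1 + m2) s y *
  normal_pdf ((m1 * s2 ^+ 2 + (y - m2) * s1 ^+ 2) / s ^+ 2) (s1 * s2 / s) x.
Proof.
move=> s10 s20.
have ss0 : 0 < s1 ^+ 2 + s2 ^+ 2 by rewrite addr_gt0// exprn_gt0.
have s0 : 0 < s by rewrite sqrtr_gt0.
have sE : s ^+ 2 = s1 ^+ 2 + s2 ^+ 2 by rewrite sqr_sqrtr// ltW.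
have t0 : 0 < s1 * s2 / s by rewrite divr_gt0// mulr_gt0.
(* From here on [s] is known only through [sE], which keeps the square root out of the field
   identities. *)
clearbody s.
rewrite !normal_pdfE ?gt_eqF// !normal_peakE// /normal_fun.
set p := (Num.sqrt _)^-1.
rewrite mulrACA [RHS]mulrACA -!expRD; congr (_ * expR _).
  by field; rewrite !gt_eqF.
rewrite !mulr2n.
have -> : (s1 * s2 / s) ^+ 2 = s1 ^+ 2 * s2 ^+ 2 / s ^+ 2.
  by rewrite exprMn [(s1 * s2) ^+ 2]exprMn exprVn.
rewrite sE.
have a0 : s1 ^+ 2 != 0 by rewrite gt_eqF// exprn_gt0.
have b0 : s2 ^+ 2 != 0 by rewrite gt_eqF// exprn_gt0.
move: ss0 a0 b0; move: (s1 ^+ 2) (s2 ^+ 2) => a b /gt_eqF/negbT ab0 a0 b0.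
by field; rewrite -!mulr2n !mulrn_eq0 !mulf_eq0 (negPf a0) (negPf b0) (negPf ab0).
Qed.

Local Open Scope ereal_scope.

(** After Tonelli, the inner integral runs over [x] with the value [y] of the sum fixed. By
    [normal_pdf_conv] the integrand is then the target density at [y] times a normal density in [x],
    which integrates to 1. *)
Lemma normal_prob_add (R : realType) (m1 m2 s1 s2 : R) (A : set R) :
  (0 < s1)%R -> (0 < s2)%R -> measurable A ->
  (normal_prob m1 s1 \x normal_prob m2 s2)
    [set p | A (p.1 + p.2)%R] =
  normal_prob (m1 + m2)%R (Num.sqrt (s1 ^+ 2 + s2 ^+ 2))%R A.
Proof.
move=> s10 s20 mA.
have madd : measurable_fun setT (fun p : measurableTypeR R * measurableTypeR R =>
    (p.1 + p.2)%R : measurableTypeR R).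
  exact: measurable_funD.
have mB : measurable [set p : measurableTypeR R * measurableTypeR R | A (p.1 + p.2)%R].
  by rewrite -[X in measurable X]setTI; exact: madd.
rewrite /product_measure1/=.
have xsE x : (normal_prob m2 s2 \o xsection [set p | A (p.1 + p.2)%R]) x
   = \int[lebesgue_measure]_(y in A) (normal_pdf m2 s2 (y - x))%:E.
  rewrite /= -normal_prob_shift//; congr normal_prob.
  by apply/seteqP; split=> y; rewrite /xsection/= inE.
have mg := @measurable_fun_xsection _ _ _ _ R (normal_prob m2 s2) _ mB.
rewrite integral_normal_prob//; last first.
  (* Integrability: the integrand is the probability of a section, hence at most 1. *)
  rewrite (@le_lt_trans _ _ (\int[normal_prob m1 s1]_x cst 1 x))//; last first.
    by rewrite integral_cst// mul1e [ltLHS](probability_setT (normal_prob m1 s1)) ltry.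
  apply: ge0_le_integral => //.
    exact: measurableT_comp.
  move=> x _; rewrite gee0_abs ?measure_ge0//; apply: probability_le1.
  exact: measurable_xsection.
have mpdf m s : measurable_fun setT (fun x : R => (normal_pdf m s x)).
  exact: measurable_normal_pdf.
have -> : \int[lebesgue_measure]_x
  ((normal_prob m2 s2 \o xsection [set p | A (p.1 + p.2)%R]) x * (normal_pdf m1 s1 x)%:E)
  = \int[lebesgue_measure]_x \int[lebesgue_measure]_y
     ((\1_A y)%:E * (normal_pdf m1 s1 x * normal_pdf m2 s2 (y - x))%:E).
  apply: eq_integral => x _; rewrite xsE muleC.
  rewrite -ge0_integralZl//=; last 3 first.
  - apply/measurable_funTS/measurable_EFinP.
    by apply: measurableT_comp => //; exact: measurable_funB.
  - by move=> y _; rewrite lee_fin normal_pdf_ge0.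
  - by rewrite lee_fin normal_pdf_ge0.
  rewrite integral_mkcond; apply: eq_integral => y _.
  by rewrite patchE indicE; case: ifP => yA; rewrite ?mul1e ?mul0e.
have mf2 : measurable_fun setT (fun p : measurableTypeR R * measurableTypeR R =>
   (\1_A p.2)%:E * (normal_pdf m1 s1 p.1 * normal_pdf m2 s2 (p.2 - p.1))%:E).
  apply: emeasurable_funM.
    apply/measurable_EFinP/measurableT_comp; last exact: measurable_snd.
    exact: measurable_indic.
  apply/measurable_EFinP; apply: measurable_funM.
    by apply: measurableT_comp => //; exact: mpdf.
  apply: measurableT_comp; first exact: mpdf.
  exact: measurable_funB.
rewrite (fubini_tonelli (fun p : measurableTypeR R * measurableTypeR R =>
   (\1_A p.2)%:E * (normal_pdf m1 s1 p.1 * normal_pdf m2 s2 (p.2 - p.1))%:E))//=; last first.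
  move=> p; rewrite -EFinM lee_fin !mulr_ge0 ?normal_pdf_ge0//.
rewrite /normal_prob [RHS]integral_mkcond; apply: eq_integral => y _.
rewrite patchE indicE; case: ifP => yA; last first.
  by under eq_integral do rewrite mul0e; rewrite integral0.
under eq_integral do rewrite mul1e normal_pdf_conv// EFinM.
rewrite ge0_integralZl//=; last 3 first.
- by apply/measurable_EFinP; exact: measurable_normal_pdf.
- by move=> x _; rewrite lee_fin normal_pdf_ge0.
- by rewrite lee_fin normal_pdf_ge0.
by rewrite integral_normal_pdf mule1.
Qed.

(** Independence is applied to [x :: r] and to [r]. Since [x] is not in [r], a single family of sets
    can take the value [B] at [x] and [A] elsewhere. *)
Lemma mutually_independent_cons d (T : measurableType d) (R : realType)
    (P : probability T R) (I : eqType) (X : I -> T -> R) (x : I) (r : seq I)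
    (B : set R) (A : I -> set R) :
  mutually_independent P X -> uniq (x :: r) ->
  measurable B -> (forall j, measurable (A j)) ->
  P (X x @^-1` B `&` \bigcap_(j in [set` r]) (X j @^-1` A j)) =
  P (X x @^-1` B) * P (\bigcap_(j in [set` r]) (X j @^-1` A j)).
Proof.
move=> indX uxr mB mA; have /andP[xr ur] := uxr.
rewrite (indX r ur A mA).
have jx j : j \in r -> (j == x) = false.
  by move=> jr; apply: contraNF xr => /eqP <-.
have := indX (x :: r) uxr (fun j => if j == x then B else A j).
rewrite big_cons eqxx.
have -> : \prod_(j <- r) P (X j @^-1` (if j == x then B else A j)) =
    \prod_(j <- r) P (X j @^-1` A j).
  by apply: eq_big_seq => j /jx ->.
move=> <-; last by move=> j; case: ifP.
congr (P _); apply/seteqP; split=> w /=.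
  move=> [Bx Ar] j /=; rewrite inE; case: eqVneq => [->//|_/=].
  exact: Ar.
move=> h; split; first by have := h x; rewrite /= eqxx inE eqxx; exact.
by move=> j jr; have := h j; rewrite /= inE jr orbT jx//; exact.
Qed.

(** The law of the pair under [P] restricted to [E], rescaled by the inverse of [P E], agrees with
    [p \x q] on rectangles; uniqueness of the product measure extends this to every measurable
    [D]. *)
Lemma preim_pair_law d (T : measurableType d) (R : realType)
    (P : probability T R) (X Y : T -> R) (E : set T)
    (p q : probability (measurableTypeR R) R) (D : set (R * R)) :
  measurable_fun setT X -> measurable_fun setT Y -> measurable E ->
  (forall A B, measurable A -> measurable B ->
    P (X @^-1` A `&` Y @^-1` B `&` E) = p A * q B * P E) ->
  measurable (D : set (measurableTypeR R * measurableTypeR R)) ->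
  P ((fun w => (X w, Y w)) @^-1` D `&` E) = (p \x q) D * P E.
Proof.
move=> mX mY mE XYE mD.
have mXY : measurable_fun setT
    (fun w => (X w, Y w) : measurableTypeR R * measurableTypeR R).
  exact: measurable_fun_pair.
have PEfin : P E \is a fin_num by exact: fin_num_measure.
(* Rescaling needs [P E] nonzero; otherwise both sides vanish. *)
have [PE0|PE0] := eqVneq (P E) 0.
  rewrite PE0 mule0; apply/eqP; rewrite -measure_le0 -PE0.
  apply: le_measure; rewrite ?inE//.
  by apply: measurableI => //; rewrite -[X in measurable X]setTI; exact: mXY.
have fPE : (0 < fine (P E))%R.
  by rewrite fine_gt0// lt0e PE0 measure_ge0 -ge0_fin_numE ?measure_ge0.
have k0 : (0 <= (fine (P E))^-1)%R by rewrite invr_ge0 ltW.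
have := @product_measure_unique _ _ _ _ R p q (mscale (NngNum k0) (pushforward (mrestr P mE)
   (fun w => (X w, Y w) : measurableTypeR R * measurableTypeR R))).
move=> /(_ mXY) h.
have -> : (p \x q) D =
    (fine (P E))^-1%:E * P ((fun w => (X w, Y w)) @^-1` D `&` E).
  apply: h => // A B mA mB; rewrite /mscale /pushforward /mrestr /=.
  transitivity ((fine (P E))^-1%:E * (p A * q B * P E)).
    by congr (_ * _); exact: XYE.
  rewrite muleCA -[X in _ * (_ * X)](fineK PEfin) -EFinM mulVf ?gt_eqF//.
  by rewrite mule1.
by rewrite muleAC -[X in _ * X * _](fineK PEfin) -EFinM mulVf ?gt_eqF// mul1e.
Qed.

(* The extra family [r] is what makes the induction go through: the sum over
   [s] stays independent of every variable outside [s]. *)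
Lemma law_sum_normal_cond d (T : measurableType d) (R : realType)
    (P : probability T R) (I : eqType) (X : I -> T -> R) (m sigma : R)
    (x : I) (s r : seq I) (B : set R) (A : I -> set R) :
  (0 < sigma)%R -> (forall i, measurable_fun setT (X i)) ->
  (forall i (D : set R), measurable D ->
     P (X i @^-1` D) = normal_prob m sigma D) ->
  mutually_independent P X -> uniq ((x :: s) ++ r) ->
  measurable B -> (forall j, measurable (A j)) ->
  P ((fun w => \sum_(i <- x :: s) X i w)%R @^-1` B `&`
     \bigcap_(j in [set` r]) (X j @^-1` A j)) =
  normal_prob (m *+ (size s).+1)%R (sigma * Num.sqrt (size s).+1%:R)%R B *
  P (\bigcap_(j in [set` r]) (X j @^-1` A j)).
Proof.
move=> s0 mX lawX indX; elim: s x r B A => [|y s IH] x r B A uxr mB mA.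
  have -> : (fun w => \sum_(i <- [:: x]) X i w)%R = X x.
    by apply/funext => w; rewrite big_seq1.
  rewrite (@mutually_independent_cons _ _ _ _ _ _ _ _ _ _ indX uxr mB mA).
  by rewrite (lawX _ _ mB) sqrtr1 mulr1 mulr1n.
have := uxr; rewrite cat_cons cons_uniq mem_cat negb_or => /andP[/andP[xys xr] uyr].
have r0 : (0 < Num.sqrt (size s).+1%:R :> R)%R by rewrite sqrtr_gt0 ltr0n.
set E := \bigcap_(j in _) _.
have mE : measurable E.
  apply: fin_bigcap_measurable => [|j _]; first exact: finite_seq.
  by rewrite -[X in measurable X]setTI; exact: mX.
set Y := fun w => (\sum_(i <- y :: s) X i w)%R.
have mY : measurable_fun setT Y by exact: measurable_sum.
have -> : (fun w => \sum_(i <- x :: y :: s) X i w)%R @^-1` B =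
   (fun w => (X x w, Y w)) @^-1` [set p | B (p.1 + p.2)%R].
  by apply/funext => w; rewrite /preimage/= big_cons.
rewrite (@preim_pair_law _ _ _ _ _ _ _ (normal_prob m sigma)
  (normal_prob (m *+ (size s).+1)%R (sigma * Num.sqrt (size s).+1%:R)%R)); 
  [|exact: mX|exact: mY|exact: mE| |].
- rewrite normal_prob_add; [|exact: s0|exact: mulr_gt0|exact: mB].
  have -> : (Num.sqrt (sigma ^+ 2 + (sigma * Num.sqrt (size s).+1%:R) ^+ 2) =
      sigma * Num.sqrt (size s).+2%:R)%R.
    rewrite exprMn sqr_sqrtr// -{1}(mulr1 (sigma ^+ 2)%R) -mulrDr.
    by rewrite sqrtrM ?sqr_ge0// sqrtr_sqr gtr0_norm// -[in RHS]natr1 addrC.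
  by rewrite -mulrS.
- move=> D D' mD mD'.
  (* The event on [x] is absorbed into the conditioning family, so the induction hypothesis with
     extra family [x :: r] yields the product formula on rectangles. *)
  pose A' j := if j == x then D else A j.
  have mA' j : measurable (A' j) by rewrite /A'; case: ifP.
  have EE : X x @^-1` D `&` E = \bigcap_(j in [set` x :: r]) (X j @^-1` A' j).
    rewrite /A'; apply/seteqP; split=> w /=.
      move=> [Dx Ar] j /=; rewrite inE; case: eqVneq => [->//|_/=].
      exact: Ar.
    move=> h; split; first by have := h x; rewrite /= eqxx inE eqxx; exact.
    move=> j jr; have := h j; rewrite /= inE jr orbT.
    have -> : (j == x) = false by apply: contraNF xr => /eqP <-.
    exact.
  have := IH y (x :: r) D' A'; rewrite -EE => h.
  have uyxr : uniq ((y :: s) ++ x :: r).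
    by rewrite -[_ ++ _]/((y :: s) ++ [:: x] ++ r) uniq_catCA.
  have uxr' : uniq (x :: r) by move: uyxr; rewrite cat_uniq => /and3P[].
  have XD : P (X x @^-1` D `&` E) = normal_prob m sigma D * P E.
    rewrite (@mutually_independent_cons _ _ _ _ _ _ _ _ _ _ indX uxr' mD mA).
    by rewrite (lawX _ _ mD).
  rewrite setIAC setIC (h uyxr mD' mA') XD muleA.
  exact: (congr1 (fun z => z * P E) (muleC _ _)).
- rewrite -[X in measurable X]setTI.
  by apply: (measurable_funD measurable_fst measurable_snd).
Qed.

Local Close Scope ereal_scope.

(** Only the interval of length [s] ending at [m - s * y] is kept. On it the density is at least its
    value at the far end [m - s * (y + 1)], and the length [s] cancels the factor [s^-1] of the
    peak. *)
Lemma normal_prob_lower_tail (R : realType) (m s y : R) : 0 < s -> 0 <= y ->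
  (((Num.sqrt (pi *+ 2))^-1 * expR (- (y + 1) ^+ 2 / 2))%:E
   <= normal_prob m s `]-oo, (m - s * y)%R]%classic)%E.
Proof.
move=> s0 y0; set c := _^-1 * _.
have c0 : 0 <= c by rewrite mulr_ge0 ?expR_ge0// invr_ge0 sqrtr_ge0.
have mi : measurable (`[m - s * (y + 1), m - s * y] : set (measurableTypeR R)).
  exact: measurable_itv.
apply: (@le_trans _ _ (normal_prob m s `[(m - s * (y + 1))%R, (m - s * y)%R]%classic)); last first.
  apply: le_measure; [by rewrite inE; exact: measurable_itv..|].
  by move=> x /=; rewrite !in_itv/= => /andP[].
have -> : c%:E = (\int[lebesgue_measure]_(x in `[(m - s * (y + 1))%R, (m - s * y)%R]) (s^-1 * c)%:E)%E.
  rewrite integral_cst//= lebesgue_measure_itv/= lte_fin ltrD2l ltrN2 ltr_pM2l//.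
  rewrite ltrDl ltr01 -EFinD -EFinM; congr EFin.
  by field; rewrite gt_eqF.
rewrite /normal_prob; apply: ge0_le_integral => //=.
- by move=> x _; rewrite lee_fin mulr_ge0// invr_ge0 ltW.
- by apply/measurable_EFinP/measurable_funTS; exact: measurable_normal_pdf.
move=> x; rewrite in_itv/= => /andP[x1 x2].
rewrite lee_fin normal_pdfE ?gt_eqF// normal_peakE// /c mulrA.
apply: ler_wpM2l; first by rewrite mulr_ge0// invr_ge0 ?ltW// sqrtr_ge0.
rewrite ler_expR !mulNr lerN2 -mulr_natr invfM mulrA ler_pM2r ?invr_gt0//.
rewrite ler_pdivrMr ?exprn_gt0// -exprMn -ler_sqrt ?sqr_ge0// !sqrtr_sqr.
rewrite [leRHS]ger0_norm; last by rewrite mulr_ge0 ?ltW// ltr_wpDl.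
rewrite ler_norml; move: x1 x2; rewrite mulrDr mulrDl mul1r mulr1 (mulrC s y) => x1 x2.
have : 0 <= y * s by rewrite mulr_ge0// ltW.
lra.
Qed.

(** * Energy balance of a window *)

Definition overflow (R : realType) (C f : R) : R :=
  pospart (f - C) + pospart (- C - f).

Lemma negpart_ge0 (R : realType) (x : R) : 0 <= negpart x.
Proof. by rewrite le_max lexx orbT. Qed.

Lemma overflow_ge0 (R : realType) (C f : R) : 0 <= overflow C f.
Proof. by rewrite addr_ge0// le_max lexx orbT. Qed.

Lemma ler_norm_overflow (R : realType) (C f : R) : `|f| <= C + overflow C f.
Proof.
have mx (x : R) : x <= pospart x /\ 0 <= pospart x.
  by rewrite /pospart !le_max !lexx orbT.
have [p1 p1_ge0] := mx (f - C); have [p2 p2_ge0] := mx (- C - f).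
by rewrite ler_norml /overflow; lra.
Qed.

(* The block consists of the nodes p + 1, ..., p + k, so that its two boundary
   edges are those of index p and p + k. *)
Lemma block_energy_balance (R : realType) (o : int -> bool) (S C : R)
    (Z Y W B F : int -> nat -> R) (p t0 k l : nat) :
  (forall i t, B i t.+1 = B i t + Y i t) ->
  (forall i t, 0 <= B i t <= S) ->
  (forall i t, Z i t - Y i t - W i t = net_outflow o (F ^~ t) i) ->
  - (k%:R * S + 2 * C * l%:R)
    - \sum_(t < l) \sum_(j < k) Z (p + j.+1)%N (t0 + t)%N <=
  \sum_(t < l) \sum_(j < k) negpart (W (p + j.+1)%N (t0 + t)%N) +
  \sum_(t < l) (overflow C (F p (t0 + t)%N) + overflow C (F (p + k)%N (t0 + t)%N)).
Proof.
move=> BY B0S bal.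
(* [G i t] is the flow from node [i] to node [i + 1] whatever the orientation, so that the net
   outflow at [i] is [G i t - G (i - 1) t]. *)
pose G (i : int) t := if o i then F i t else - F i t.
have GF i t : `|G i t| <= C + overflow C (F i t).
  by rewrite /G; case: ifP => _; rewrite ?normrN ler_norm_overflow.
have sumZ t : \sum_(j < k) Z (p + j.+1)%N t =
    \sum_(j < k) Y (p + j.+1)%N t + \sum_(j < k) W (p + j.+1)%N t
    + (G (p + k)%N t - G p t).
  (* Interior edges cancel by telescoping; only the two boundary edges survive. *)
  have -> : G (p + k)%N t - G p t =
      \sum_(j < k) (G (p + j.+1)%N t - G (p + j)%N t).
    rewrite -(big_mkord xpredT (fun j => G (p + j.+1)%N t - G (p + j)%N t)).
    by rewrite (telescope_sumr (fun j => G (p + j)%N t))// addn0.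
  rewrite -!big_split/=; apply: eq_bigr => j _.
  have := bal (p + j.+1)%N t; rewrite /net_outflow.
  have -> : (p + j.+1)%N%:Z - 1 = (p + j)%N by rewrite addnS -addn1 PoszD addrK.
  rewrite /G; case: ifP => _; case: ifP => _; lra.
have sumY : - (k%:R * S) <= \sum_(t < l) \sum_(j < k) Y (p + j.+1)%N (t0 + t)%N.
  rewrite exchange_big/= -mulrN mulr_natl.
  have -> : - S *+ k = \sum_(j < k) - S by rewrite sumr_const card_ord.
  apply: ler_sum => j _.
  (* Storage increments telescope in time, so each node releases at most [S] over the window,
     whatever its initial charge. *)
  have -> : \sum_(t < l) Y (p + j.+1)%N (t0 + t)%N =
      B (p + j.+1)%N (t0 + l)%N - B (p + j.+1)%N t0.
    rewrite -(big_mkord xpredT (fun t => Y (p + j.+1)%N (t0 + t)%N)).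
    have YB t : Y (p + j.+1)%N (t0 + t)%N =
        B (p + j.+1)%N (t0 + t.+1)%N - B (p + j.+1)%N (t0 + t)%N.
      by rewrite [(t0 + t.+1)%N]addnS BY addrC addKr.
    under eq_bigr do rewrite YB.
    by rewrite (telescope_sumr (fun t => B (p + j.+1)%N (t0 + t)%N))// addn0.
  have /andP[] := B0S (p + j.+1)%N (t0 + l)%N.
  have /andP[] := B0S (p + j.+1)%N t0; lra.
under eq_bigr do rewrite sumZ.
rewrite !big_split/=.
have sumW : - \sum_(t < l) \sum_(j < k) negpart (W (p + j.+1)%N (t0 + t)%N) <=
    \sum_(t < l) \sum_(j < k) W (p + j.+1)%N (t0 + t)%N.
  rewrite -sumrN; apply: ler_sum => t _; rewrite -sumrN; apply: ler_sum => j _.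
  by rewrite lerNl /negpart le_max lexx.
have sumG : - (2 * C * l%:R) - (\sum_(t < l) overflow C (F p (t0 + t)%N) +
      \sum_(t < l) overflow C (F (p + k)%N (t0 + t)%N)) <=
    \sum_(t < l) (G (p + k)%N (t0 + t)%N - G p (t0 + t)%N).
  have -> : 2 * C * l%:R = \sum_(t < l) (2 * C).
    by rewrite sumr_const card_ord mulr_natr.
  rewrite -opprD -!big_split/= -sumrN; apply: ler_sum => t _.
  have := GF p (t0 + t)%N; have := GF (p + k)%N (t0 + t)%N.
  by rewrite !ler_norml => /andP[? ?] /andP[? ?]; lra.
rewrite !big_split/= in sumG; lra.
Qed.

(** * Expectations and averaging over window positions *)

Local Open Scope ereal_scope.

Lemma expectation_ge0_sum d (T : measurableType d) (R : realType)
    (P : probability T R) (I : Type) (s : seq I) (f : I -> T -> R) :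
  (forall i, measurable_fun setT (f i)) -> (forall i w, (0 <= f i w)%R) ->
  'E_P[fun w => (\sum_(i <- s) f i w)%R] = \sum_(i <- s) 'E_P[f i].
Proof.
move=> mf f0; rewrite unlock -ge0_integral_sum//.
- by apply: eq_integral => w _; rewrite sumEFin.
- by move=> i; exact/measurable_EFinP.
- by move=> i w _; rewrite lee_fin.
Qed.

Lemma expectation_ge0D d (T : measurableType d) (R : realType)
    (P : probability T R) (f g : T -> R) :
  measurable_fun setT f -> measurable_fun setT g ->
  (forall w, 0 <= f w)%R -> (forall w, 0 <= g w)%R ->
  'E_P[fun w => (f w + g w)%R] = 'E_P[f] + 'E_P[g].
Proof.
move=> mf mg f0 g0; rewrite unlock -ge0_integralD//.
- by move=> w _; rewrite lee_fin.
- exact/measurable_EFinP.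
- by move=> w _; rewrite lee_fin.
- exact/measurable_EFinP.
Qed.

Lemma exchange_big3 (R : realType) (a b l : nat) (g : nat -> nat -> nat -> \bar R) :
  \sum_(x < a) \sum_(y < b) \sum_(z < l) g x y z =
  \sum_(z < l) \sum_(x < a) \sum_(y < b) g x y z.
Proof.
rewrite [RHS]exchange_big/=; apply: eq_bigr => x _.
by rewrite exchange_big.
Qed.

Lemma lee_sum_shift (R : realType) (a c n : nat) (f : nat -> \bar R) :
  (forall i, 0 <= f i) -> (a + c <= n)%N ->
  \sum_(p < a) f (p + c)%N <= \sum_(i < n) f i.
Proof.
move=> f0 acn.
rewrite -(big_mkord xpredT (fun p => f (p + c)%N)) -(big_mkord xpredT f).
have -> : \sum_(0 <= p < a) f (p + c)%N = \sum_(c <= i < a + c) f i.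
  by rewrite -{2}[c]add0n big_addn addnK.
have cn : (c <= n)%N by exact: leq_trans (leq_addl _ _) acn.
rewrite [leRHS](big_cat_nat (leq0n c) cn)/=.
rewrite [X in _ <= _ + X](big_cat_nat (leq_addl a c) acn)/=.
by rewrite addeCA leeDl// adde_ge0// sume_ge0.
Qed.

Lemma lee_sum_shift2 (R : realType) (a c e n N : nat) (f : nat -> nat -> \bar R) :
  (forall i t, 0 <= f i t) -> (a + c <= N)%N -> (a + e <= n)%N ->
  \sum_(t < a) \sum_(p < a) f (p + c)%N (t + e)%N <=
  \sum_(t < n) \sum_(i < N) f i t.
Proof.
move=> f0 acN aen.
apply: le_trans (@lee_sum_shift _ _ _ _ (fun t => \sum_(i < N) f i t) _ aen).
  by apply: lee_sum => t _; exact: (@lee_sum_shift _ _ _ _ (f ^~ (t + e)%N)).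
by move=> t; rewrite sume_ge0.
Qed.

Lemma sume_split (R : realType) (n : nat) (f g : nat -> \bar R) :
  \sum_(i < n) (f i + g i) = \sum_(i < n) f i + \sum_(i < n) g i.
Proof. exact: big_split. Qed.

(* Every site lies in at most k * l windows and every edge-time pair on the
   boundary of at most 2 * l of them. *)
Lemma sliding_windows (R : realType) (a k l n : nat)
    (w e : nat -> nat -> \bar R) (x : \bar R) :
  (forall i t, 0 <= w i t) -> (forall i t, 0 <= e i t) ->
  (a + k < n)%N -> (a + l <= n)%N ->
  (forall p t0, x <=
     \sum_(t < l) \sum_(j < k) w (p + j.+1)%N (t0 + t)%N +
     \sum_(t < l) (e p (t0 + t)%N + e (p + k)%N (t0 + t)%N)) ->
  (a * a)%:R%:E * x <=
  (k * l)%:R%:E * (\sum_(t < n) \sum_(i < n) w i t) +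
  (2 * l)%:R%:E * (\sum_(t < n) \sum_(i < n.-1) e i t).
Proof.
move=> w0 e0 akn aln xle.
have sumc (m : nat) (y : \bar R) : \sum_(i < m) y = m%:R%:E * y.
  by rewrite big_const card_ord iter_addr addr0 mule_natl.
have n0 : (0 < n)%N by exact: leq_ltn_trans akn.
have -> : (a * a)%:R%:E * x = \sum_(t0 < a) \sum_(p < a) x.
  under eq_bigr do rewrite sumc.
  by rewrite sumc natrM EFinM muleA.
pose f1 p t0 t := \sum_(j < k) w (p + j.+1)%N (t0 + t)%N.
pose f2 p t0 t := e p (t0 + t)%N + e (p + k)%N (t0 + t)%N.
apply: (@le_trans _ _ (\sum_(t0 < a) \sum_(p < a)
    (\sum_(t < l) f1 p t0 t + \sum_(t < l) f2 p t0 t))).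
  by apply: lee_sum => t0 _; apply: lee_sum => p _; exact: xle.
under eq_bigr do rewrite big_split/=.
rewrite big_split/=; apply: leeD.
  (* For a fixed cell of the window, sliding the window visits distinct sites of the box; each of
     the [k * l] cells thus contributes at most the full sum. *)
  rewrite (exchange_big3 _ _ _ (fun t0 p t => f1 p t0 t)).
  rewrite mulnC natrM EFinM -muleA -!sumc; apply: lee_sum => t _.
  rewrite (@exchange_big3 _ _ _ _ (fun t0 p j => w (p + j.+1)%N (t0 + t)%N)).
  apply: lee_sum => j _.
  apply: lee_sum_shift2 => //; have := ltn_ord j; have := ltn_ord t; lia.
rewrite (exchange_big3 _ _ _ (fun t0 p t => f2 p t0 t)).
rewrite mulnC natrM EFinM -muleA -sumc; apply: lee_sum => t _.
have -> : \sum_(t0 < a) \sum_(p < a) f2 p t0 t =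
    \sum_(t0 < a) \sum_(p < a) e p (t0 + t)%N +
    \sum_(t0 < a) \sum_(p < a) e (p + k)%N (t0 + t)%N.
  rewrite -(sume_split a (fun t0 => \sum_(p < a) e p (t0 + t)%N)
    (fun t0 => \sum_(p < a) e (p + k)%N (t0 + t)%N)).
  apply: eq_bigr => t0 _.
  by rewrite (sume_split a (fun p => e p (t0 + t)%N) (fun p => e (p + k)%N (t0 + t)%N)).
have tl := ltn_ord t.
rewrite -sumc big_ord_recl big_ord1; apply: leeD.
  apply: le_trans (@lee_sum_shift2 _ a 0 t n n.-1 e e0 _ _); [|lia|lia].
  by apply: lee_sum => t0 _; apply: lee_sum => p _; rewrite addn0.
(* The strict inequality [a + k < n] is what keeps the right boundary edges within the [n.-1] edges
   of the box. *)
by apply: (@lee_sum_shift2 _ a k t n n.-1 e e0); lia.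
Qed.

Local Close Scope ereal_scope.

(** * Choice of the window *)

(** The first bound controls the deficit threshold, drift included, in units of the standard
    deviation. The second limits the number of cells, whose square root is lost in the averaging. *)
Lemma window_shape (R : realType) (S C m : R) :
  0 < S -> 0 < C -> 0 <= m -> m <= Num.min C S ->
  exists k l : nat, [/\ (0 < k)%N, (0 < l)%N,
    (k%:R * S + 2 * C * l%:R + (k * l)%:R * m) ^+ 2 <= 49 * (C * S) * (k * l)%:R &
    (k * l)%:R * Num.min C S ^+ 2 <= 2 * (C * S)].
Proof.
move=> S0 C0 m0; rewrite le_min => /andP[mC mS].
(* Rounding up a real that is at least 1 at most doubles it. *)
have tr (x : R) : 1 <= x -> exists k : nat, [/\ (0 < k)%N, x <= k%:R & k%:R <= 2 * x].
  move=> x1; exists (Num.truncn x).+1; split=> //.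
    by have /andP[_ /ltW] := @truncn_itv _ x (le_trans ler01 x1).
  have /andP[] := @truncn_itv _ x (le_trans ler01 x1).
  by rewrite -natr1; lra.
have [SC|CS] := leP S C.
  have [|k [k0 k1 k2]] := tr (C / S); first by rewrite ler_pdivlMr// mul1r.
  rewrite ler_pdivrMr// in k1; rewrite mulrA ler_pdivlMr// in k2.
  exists k, 1%N; split=> //; rewrite muln1.
    have h1 : k%:R * m <= k%:R * S by rewrite ler_wpM2l.
    have h2 : 0 <= k%:R * m by rewrite mulr_ge0.
    (* Here [k * S], [2 * C] and [k * m] are each at most [2 * C], so 6 would do; 7 is dictated by
       the other case. *)
    apply: (@le_trans _ _ ((7 * C) ^+ 2)).
      by rewrite ler_sqr ?nnegrE; lra.
    have : C * C <= C * (k%:R * S) by rewrite ler_wpM2l// ltW.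
    rewrite expr2; lra.
  have : S * (k%:R * S) <= S * (2 * C) by rewrite ler_wpM2l// ltW.
  rewrite expr2; lra.
have [|l [l0 l1 l2]] := tr (S / C); first by rewrite ler_pdivlMr// mul1r ltW.
rewrite ler_pdivrMr// in l1; rewrite mulrA ler_pdivlMr// in l2.
exists 1%N, l; split=> //; rewrite mul1n.
  have h1 : l%:R * m <= l%:R * C by rewrite ler_wpM2l.
  have h2 : 0 <= l%:R * m by rewrite mulr_ge0.
  (* The three terms are at most [S], [4 * S] and [2 * S]. *)
  apply: (@le_trans _ _ ((7 * S) ^+ 2)).
    by rewrite ler_sqr ?nnegrE; lra.
  have : S * S <= S * (l%:R * C) by rewrite ler_wpM2l// ltW.
  rewrite expr2; lra.
have : C * (l%:R * C) <= C * (2 * S) by rewrite ler_wpM2l// ltW.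
rewrite expr2; lra.
Qed.

(** Every loss is turned into a power of [expR M], using [1 < M]: 53 for the Gaussian exponent, 2
    for the peak, 5 for the factor 32 and 2 for the square root of [N], in total 62. *)
Lemma window_constant (R : realType) (S C sigma th N M s : R) :
  0 < S -> 0 < C -> 0 < sigma -> 1 <= N -> 0 <= th ->
  M = C * S / sigma ^+ 2 -> Num.max (ln (sigma / Num.min C S)) 1 < M ->
  th ^+ 2 <= 49 * (C * S) * N -> N * Num.min C S ^+ 2 <= 2 * (C * S) ->
  s = sigma * Num.sqrt N ->
  sigma * expR (- 62 * M) <=
  s * ((Num.sqrt (pi *+ 2))^-1 * expR (- ((th + s) / s + 1) ^+ 2 / 2)) / (32 * N).
Proof.
move=> S0 C0 s0 N1 th0 ME; rewrite gt_max => /andP[lnM M1] thN Nmin sE.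
have N0 : 0 < N by lra.
have sN0 : 0 < Num.sqrt N by rewrite sqrtr_gt0.
have sp : 0 < s by rewrite sE mulr_gt0.
have ss : s ^+ 2 = sigma ^+ 2 * N by rewrite sE exprMn sqr_sqrtr// ltW.
have s20 : 0 < sigma ^+ 2 by rewrite exprn_gt0.
have CSE : C * S = M * sigma ^+ 2 by rewrite ME divfK// gt_eqF.
have min0 : 0 < Num.min C S by rewrite lt_min C0 S0.
set mi := Num.min C S in lnM Nmin min0.
pose q := th / s.
have q0 : 0 <= q by rewrite divr_ge0// ltW.
have q2 : q ^+ 2 <= 49 * M.
  rewrite /q exprMn exprVn ler_pdivrMr ?exprn_gt0// ss.
  by rewrite (le_trans thN)// CSE; lra.
have -> : (th + s) / s + 1 = q + 2 by rewrite /q mulrDl divff ?gt_eqF//; lra.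
(* Since [(q + 2) ^+ 2 / 2 <= q ^+ 2 + 4], the exponent is at most [49 * M + 4]. *)
have gauss : expR (- (53 * M)) <= expR (- (q + 2) ^+ 2 / 2).
  rewrite ler_expR; have : 0 <= (q - 2) ^+ 2 by rewrite sqr_ge0.
  by rewrite !expr2 in q2 *; lra.
have peak : expR (- (2 * M)) <= (Num.sqrt (pi *+ 2))^-1.
  have pi2 : 0 < pi *+ 2 :> R by rewrite mulrn_wgt0// pi_gt0.
  rewrite expRN lef_pV2 ?posrE ?expR_gt0 ?sqrtr_gt0//.
  apply: (@le_trans _ _ 3); last first.
    by apply: le_trans (expR_ge1Dx _) => /=; lra.
  have -> : 3 = Num.sqrt (3 ^+ 2) :> R by rewrite sqrtr_sqr ger0_norm.
  rewrite ler_sqrt ?exprn_ge0// mulr2n expr2.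
  by have := @pihalf_lt2 R; lra.
(* This is the only use of the logarithmic hypothesis. *)
have sigM : sigma <= mi * expR M.
  rewrite mulrC -ler_pdivrMr// -[leLHS]lnK ?posrE ?divr_gt0//.
  by rewrite ler_expR ltW.
(* Combining [sigM] with the bound on the number of cells gives [N <= 2 * M * expR M ^+ 2], which is
   at most [expR (4 * M)]. *)
have NM : Num.sqrt N <= expR (2 * M).
  have e0 := expR_gt0 M.
  have h1 : N * sigma ^+ 2 <= 2 * (M * sigma ^+ 2) * expR M ^+ 2.
    rewrite -CSE; apply: le_trans (_ : N * (mi * expR M) ^+ 2 <= _).
      apply: ler_wpM2l; first exact: ltW.
      apply: lerXn2r => //; rewrite nnegrE; first exact: ltW.
      by apply: mulr_ge0; apply: ltW.
    rewrite exprMn [leLHS]mulrA; apply: ler_wpM2r => //.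
  have h2 : N <= 2 * M * expR M ^+ 2.
    by rewrite -(ler_pM2r s20) (le_trans h1)//; lra.
  have h3 : 2 * M <= expR (2 * M).
    by apply: le_trans (expR_ge1Dx _); lra.
  have -> : expR (2 * M) = Num.sqrt (expR (2 * M) ^+ 2).
    by rewrite sqrtr_sqr ger0_norm// expR_ge0.
  rewrite ler_sqrt ?exprn_ge0 ?expR_ge0//.
  have h4 : expR (2 * M) = expR M ^+ 2 by rewrite expr2 -expRD; congr expR; lra.
  apply: le_trans h2 _; rewrite -h4 expr2; apply: ler_wpM2r => //.
have e32 : 32 <= expR (5 * M).
  have h : 2 <= expR (1 : R) by apply: le_trans (expR_ge1Dx _); lra.
  apply: (@le_trans _ _ (expR 1 ^+ 5)); last by rewrite -expRM_natl ler_expR; lra.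
  apply: le_trans (_ : 2 ^+ 5 <= _); first by rewrite !exprS expr0; lra.
  by apply: lerXn2r => //; rewrite nnegrE// expR_ge0.
rewrite {1}sE ler_pdivlMr; last by lra.
rewrite -!mulrA ler_pM2l//.
(* The factor [s] carries one square root of [N], so division by [N] leaves one more to absorb. *)
have NE : N = Num.sqrt N * Num.sqrt N by rewrite -expr2 sqr_sqrtr// ltW.
rewrite [X in _ * (32 * X)]NE.
rewrite [leLHS](_ : _ = Num.sqrt N * (expR (- 62 * M) * 32 * Num.sqrt N)); last by ring.
rewrite ler_pM2l//.
apply: (@le_trans _ _ (expR (- 62 * M) * expR (5 * M) * expR (2 * M))).
  by apply: ler_pM => //; rewrite ler_wpM2l.
rewrite -!expRD.
apply: (@le_trans _ _ (expR (- (2 * M)) * expR (- (53 * M)))).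
  by rewrite -expRD ler_expR; lra.
by apply: ler_pM.
Qed.

(** * From the cost of one window to the limit inferior *)

Local Open Scope ereal_scope.

Lemma limn_einf_ge (R : realType) (u : (\bar R)^nat) (x : \bar R) (N : nat) :
  (forall n, (N <= n)%N -> x <= u n) -> x <= limn_einf u.
Proof.
move=> xu; rewrite limn_einf_lim; apply: lime_ge; first exact: is_cvg_einfs.
exists N => // n /= Nn; apply: le_ereal_inf_tmp => _ [p /= np <-].
exact/xu/(leq_trans Nn).
Qed.

(** The case of an empty extra family, where the conditioning event is the whole space. *)
Lemma law_sum_normal d (T : measurableType d) (R : realType)
    (P : probability T R) (I : eqType) (X : I -> T -> R) (m sigma : R)
    (s : seq I) (B : set R) :
  (0 < sigma)%R -> (forall i, measurable_fun setT (X i)) ->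
  (forall i (D : set R), measurable D ->
     P (X i @^-1` D) = normal_prob m sigma D) ->
  mutually_independent P X -> uniq s -> (0 < size s)%N -> measurable B ->
  P ((fun w => \sum_(i <- s) X i w)%R @^-1` B) =
  normal_prob (m *+ size s)%R (sigma * Num.sqrt (size s)%:R)%R B.
Proof.
move=> s0 mX lawX indX us ss mB; case: s us ss => // x s us _.
have us0 : uniq ((x :: s) ++ [::]) by rewrite cats0.
have := @law_sum_normal_cond _ _ _ P _ X m sigma x s [::] B (fun=> setT)
  s0 mX lawX indX us0 mB (fun=> measurableT).
have -> : \bigcap_(j in [set` [::]]) (X j @^-1` setT) = setT.
  by apply/seteqP; split.
by rewrite probability_setT mule1 setIT.
Qed.

(** A duplicate-free list of space-time indices, the form in which [mutually_independent] takes its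
    finite families. *)
Definition window (p t0 k l : nat) : seq (int * nat) :=
  [seq ((p + j.+1)%N%:Z, (t0 + t)%N) | t <- iota 0 l, j <- iota 0 k].

Lemma size_window p t0 k l : size (window p t0 k l) = (k * l)%N.
Proof. by rewrite size_allpairs !size_iota mulnC. Qed.

Lemma uniq_window p t0 k l : uniq (window p t0 k l).
Proof.
apply: allpairs_uniq; rewrite ?iota_uniq// => -[t j] [t' j'] _ _ /= [].
by move=> /addnI[<-] /addnI <-.
Qed.

Lemma big_window (R : realType) p t0 k l (f : int -> nat -> R) :
  (\sum_(i <- window p t0 k l) f i.1 i.2 =
   \sum_(t < l) \sum_(j < k) f (p + j.+1)%N (t0 + t)%N)%R.
Proof.
rewrite big_allpairs_dep/= -(big_mkord xpredT
  (fun t => \sum_(j < k) f (p + j.+1)%N (t0 + t)%N))%R /index_iota subn0.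
by apply: eq_bigr => t _; rewrite -(big_mkord xpredT
  (fun j => f (p + j.+1)%N (t0 + t)%N))/= /index_iota subn0.
Qed.

(** The sum has mean [(k * l)%:R * m] and standard deviation [s], so the threshold [- (th + s)] lies
    [(th + (k * l)%:R * m + s) / s] deviations below the mean. *)
Lemma window_sum_lower_tail d (T : measurableType d) (R : realType)
    (P : probability T R) (m sigma : R) (Z : int -> nat -> T -> R)
    (p t0 k l : nat) (th s : R) :
  (0 < sigma)%R -> iid_gaussian P m sigma Z -> (0 < k)%N -> (0 < l)%N ->
  (0 <= th + (k * l)%:R * m)%R -> s = (sigma * Num.sqrt (k * l)%:R)%R ->
  (((Num.sqrt (pi *+ 2))^-1 *
     expR (- ((th + (k * l)%:R * m + s) / s + 1) ^+ 2 / 2))%R)%:E <=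
  P [set w | (\sum_(t < l) \sum_(j < k) Z (p + j.+1)%N (t0 + t)%N w <=
              - (th + s))%R].
Proof.
move=> s0 [mZ [lawZ indZ]] k0 l0 th0 sE.
have kl0 : (0 < k * l)%N by rewrite muln_gt0 k0.
have sp : (0 < s)%R by rewrite sE mulr_gt0// sqrtr_gt0 ltr0n.
set y := ((th + (k * l)%:R * m + s) / s)%R.
have y0 : (0 <= y)%R by apply: divr_ge0; [apply: addr_ge0 => //|]; exact: ltW.
have -> : [set w | (\sum_(t < l) \sum_(j < k) Z (p + j.+1)%N (t0 + t)%N w <=
      - (th + s))%R] =
    (fun w => \sum_(i <- window p t0 k l) (fun u => Z u.1 u.2) i w)%R @^-1`
      `]-oo, (m *+ (k * l) - s * y)%R]%classic.
  have -> : (m *+ (k * l) - s * y = - (th + s))%R.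
    rewrite /y mulrCA divff ?gt_eqF// mulr1 -mulr_natl; ring.
  apply/seteqP; split=> w /=;
    by rewrite in_itv/= (big_window p t0 k l (fun i t => Z i t w)).
have mI : measurable (`]-oo, (m *+ (k * l) - s * y)%R]%classic : set R).
  exact: measurable_itv.
have := @law_sum_normal _ _ _ P _ (fun u => Z u.1 u.2) m sigma
  (window p t0 k l) _ s0 (fun u => mZ u.1 u.2) (fun u => lawZ u.1 u.2) indZ
  (uniq_window p t0 k l) _ mI.
rewrite size_window -sE => ->; last exact: kl0.
exact: normal_prob_lower_tail.
Qed.

Lemma measurable_negpart d (T : measurableType d) (R : realType) (f : T -> R) :
  measurable_fun setT f -> measurable_fun setT (fun w => negpart (f w)).
Proof.
move=> mf; apply: measurable_maxr; last exact: measurable_cst.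
exact: measurable_funN.
Qed.

Lemma measurable_overflow d (T : measurableType d) (R : realType) (C : R)
    (f : T -> R) :
  measurable_fun setT f -> measurable_fun setT (fun w => overflow C (f w)).
Proof.
by move=> mf; apply: measurable_funD; apply: measurable_maxr => //;
  exact: measurable_funB.
Qed.

(** A Markov-type bound: on the event, [block_energy_balance] forces a cost of at least [s];
    elsewhere the cost is nonnegative. *)
Lemma window_cost d (T : measurableType d) (R : realType)
    (P : probability T R) (o : int -> bool) (S C s : R)
    (Z Y W B F : int -> nat -> T -> R) (p t0 k l : nat) :
  (0 < s)%R -> (forall i t, measurable_fun setT (Z i t)) ->
  control_scheme o S Z Y W B F ->
  s%:E * P [set w | (\sum_(t < l) \sum_(j < k) Z (p + j.+1)%N (t0 + t)%N w <=
                     - (k%:R * S + 2 * C * l%:R + s))%R] <=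
  \sum_(t < l) \sum_(j < k)
     'E_P[fun w => negpart (W (p + j.+1)%N (t0 + t)%N w)] +
  \sum_(t < l) ('E_P[fun w => overflow C (F p (t0 + t)%N w)] +
                'E_P[fun w => overflow C (F (p + k)%N (t0 + t)%N w)]).
Proof.
move=> s0 mZ [_ [mW [_ [mF [_ [BY [B0S bal]]]]]]].
set D := [set w | _].
have mD : measurable D.
  have -> : D = (fun w => \sum_(t < l) \sum_(j < k)
       Z (p + j.+1)%N (t0 + t)%N w)%R @^-1`
       `]-oo, (- (k%:R * S + 2 * C * l%:R + s))%R]%classic.
    by apply/seteqP; split=> w /=; rewrite in_itv.
  rewrite -[X in measurable X]setTI.
  have mZs : measurable_fun setT (fun w => \sum_(t < l) \sum_(j < k)
      Z (p + j.+1)%N (t0 + t)%N w)%R.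
    by apply: measurable_sum => t; exact: measurable_sum.
  by apply: mZs => //; exact: measurable_itv.
pose f1 (t : 'I_l) w := (\sum_(j < k) negpart (W (p + j.+1)%N (t0 + t)%N w))%R.
pose f2 (t : 'I_l) w := (overflow C (F p (t0 + t)%N w) +
  overflow C (F (p + k)%N (t0 + t)%N w))%R.
have mf1 t : measurable_fun setT (f1 t).
  by apply: measurable_sum => j; exact: measurable_negpart.
have mf2 t : measurable_fun setT (f2 t).
  by apply: measurable_funD; exact: measurable_overflow.
have f10 t w : (0 <= f1 t w)%R by apply: sumr_ge0 => j _; exact: negpart_ge0.
have f20 t w : (0 <= f2 t w)%R by rewrite addr_ge0// overflow_ge0.
have -> : \sum_(t < l) \sum_(j < k)
     'E_P[fun w => negpart (W (p + j.+1)%N (t0 + t)%N w)] =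
   'E_P[fun w => \sum_(t < l) f1 t w]%R.
  rewrite expectation_ge0_sum//; apply: eq_bigr => t _.
  rewrite expectation_ge0_sum//.
  - by move=> j; exact: measurable_negpart.
  - by move=> j w; exact: negpart_ge0.
have -> : \sum_(t < l) ('E_P[fun w => overflow C (F p (t0 + t)%N w)] +
     'E_P[fun w => overflow C (F (p + k)%N (t0 + t)%N w)]) =
   'E_P[fun w => \sum_(t < l) f2 t w]%R.
  rewrite expectation_ge0_sum//; apply: eq_bigr => t _.
  apply/esym/expectation_ge0D => [||w|w]; try exact: overflow_ge0.
  - exact: measurable_overflow.
  - exact: measurable_overflow.
rewrite -expectation_ge0D//; last 4 first.
- exact: measurable_sum.
- exact: measurable_sum.
- by move=> w; apply: sumr_ge0.
- by move=> w; apply: sumr_ge0.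
rewrite -expectation_indic// unlock -ge0_integralZl//=; last 2 first.
- by apply/measurable_EFinP; exact: measurable_indic.
- by rewrite lee_fin ltW.
apply: ge0_le_integral => //=.
- by move=> w _; rewrite -EFinM lee_fin mulr_ge0// ltW.
- apply/measurable_EFinP; apply: measurable_funM => //; exact: measurable_indic.
- by apply/measurable_EFinP; apply: measurable_funD; exact: measurable_sum.
move=> w _; rewrite -EFinM lee_fin indicE.
have [wD|_] := boolP (w \in D); last first.
  by rewrite mulr0 addr_ge0//; apply: sumr_ge0.
rewrite mulr1; move: wD; rewrite inE /D/= => wD.
have := @block_energy_balance R o S C (fun i t => Z i t w) (fun i t => Y i t w)
  (fun i t => W i t w) (fun i t => B i t w) (fun i t => F i t w) p t0 k l
  (fun i t => BY i t w) (fun i t => B0S i t w) (fun i t => bal i t w).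
apply: le_trans; lra.
Qed.

(** The window takes [n./2] positions in each direction. The constant 32 is 2 from the counting
    multiplicities times 16 from [n <= 4 * n./2], squared. *)
Lemma eps_tot_ge_window d (T : measurableType d) (R : realType)
    (P : probability T R) (C x : R) (W F : int -> nat -> T -> R) (k l n : nat) :
  (0 < k)%N -> (0 < l)%N -> (0 <= x)%R -> (2 * (k + l + 2) <= n)%N ->
  (forall p t0 : nat, x%:E <=
    \sum_(t < l) \sum_(j < k)
       'E_P[fun w => negpart (W (p + j.+1)%N (t0 + t)%N w)] +
    \sum_(t < l) ('E_P[fun w => overflow C (F p (t0 + t)%N w)] +
                  'E_P[fun w => overflow C (F (p + k)%N (t0 + t)%N w)])) ->
  (x / (32 * (k * l)%:R))%:E <= eps_tot P C W F n.
Proof.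
move=> k0 l0 x0 nkl xle.
pose w (i t : nat) := 'E_P[fun u => negpart (W i t u)].
pose e (i t : nat) := 'E_P[fun u => overflow C (F i t u)].
have w0 i t : 0 <= w i t by apply: expectation_ge0 => u; exact: negpart_ge0.
have e0 i t : 0 <= e i t by apply: expectation_ge0 => u; exact: overflow_ge0.
have akn : (n./2 + k < n)%N by lia.
have aln : (n./2 + l <= n)%N by lia.
have := sliding_windows w0 e0 akn aln xle.
rewrite /eps_tot -[X in _ -> _ <= _ + _ * X]/(\sum_(t < n) \sum_(i < n.-1) e i t).
rewrite -[X in _ -> _ <= _ * X + _]/(\sum_(t < n) \sum_(i < n) w i t).
set a := n./2; set A := \sum_(t < n) \sum_(i < n) _.
set B := \sum_(t < n) \sum_(i < n.-1) _ => main.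
have A0 : 0 <= A by apply: sume_ge0 => t _; apply: sume_ge0.
have B0 : 0 <= B by apply: sume_ge0 => t _; apply: sume_ge0.
have kl0 : (0 < k * l)%N by rewrite muln_gt0 k0.
have n0 : (0 < n)%N by lia.
have nn0 : (0 < (n * n)%:R :> R)%R by rewrite ltr0n muln_gt0 n0.
(* The multiplicities [k * l] of sites and [2 * l] of edges are both at most [2 * (k * l)]. *)
have AB : ((a * a)%:R * x)%:E <= (2 * (k * l))%:R%:E * (A + B).
  rewrite EFinM ge0_muleDr//; apply: (le_trans main); apply: leeD.
    by apply: lee_wpmul2r => //; rewrite lee_fin ler_nat; lia.
  by apply: lee_wpmul2r => //; rewrite lee_fin ler_nat; nia.
(* The edge normalisation by [n * (n - 1)] is the larger weight, so both sums may be weighted by the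
   inverse of [n * n]. *)
apply: (@le_trans _ _ (((n * n)%:R)^-1%:E * (A + B))); last first.
  rewrite ge0_muleDr//; apply: leeD => //; apply: lee_wpmul2r => //.
  rewrite lee_fin lef_pV2 ?posrE// ?ler_nat ?ltr0n; last by nia.
  by rewrite leq_mul2l leq_subr orbT.
rewrite lee_pdivlMl// -EFinM.
rewrite -lee_pdivrMl -?EFinM in AB; last by rewrite ltr0n muln_gt0.
apply: le_trans AB; rewrite lee_fin mulrC -subr_ge0.
have n4a : (n <= 4 * a)%N by rewrite /a; lia.
have nnaa : ((n * n)%:R <= 16 * (a * a)%:R :> R)%R.
  by rewrite -natrM ler_nat; nia.
set N := (k * l)%N; have N0 : (0 < N%:R :> R)%R by rewrite ltr0n.
have -> : ((2 * N)%:R^-1 * ((a * a)%:R * x) - x / (32 * N%:R) * (n * n)%:R =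
   x / (32 * N%:R) * (16 * (a * a)%:R - (n * n)%:R))%R.
  by rewrite natrM; field; rewrite gt_eqF.
by rewrite mulr_ge0 ?subr_ge0// divr_ge0// mulr_ge0// ltW.
Qed.

Local Close Scope ereal_scope.
Unset Implicit Arguments.

Theorem mainTheorem6 (R : realType) :
  exists c : R,
  forall (d : measure_display) (T : measurableType d) (P : probability T R)
         (S C m sigma : R) (Z : int -> nat -> T -> R),
    0 < S -> 0 < C -> 0 < sigma ->
    0 <= m -> m <= Num.min C S ->
    Num.max (ln (sigma / Num.min C S)) 1 < C * S / sigma ^+ 2 ->
    iid_gaussian P m sigma Z ->
    forall (o : int -> bool) (Y W B F : int -> nat -> T -> R),
      control_scheme o S Z Y W B F ->
      ((sigma * expR (- c * (C * S / sigma ^+ 2)))%:E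
         <= limn_einf (eps_tot P C W F))%E.
Proof.
(* The constant is the total exponent collected in [window_constant]; it is fixed before the
   probability space and all parameters. *)
exists 62 => d T P S C m sigma Z S0 C0 sigma0 m0 mCS hM iidZ o Y W B F ctrl.
have [k [l [k0 l0 thsq Nmin]]] := window_shape S0 C0 m0 mCS.
have N1 : 1 <= (k * l)%:R :> R by rewrite ler1n muln_gt0 k0.
pose s := sigma * Num.sqrt (k * l)%:R.
have s0 : 0 < s by rewrite mulr_gt0// sqrtr_gt0; apply: lt_le_trans N1.
have kS0 : 0 <= k%:R * S + 2 * C * l%:R.
  by apply: addr_ge0; apply: mulr_ge0 => //; [exact: ltW|apply: mulr_ge0 => //; exact: ltW].
have th0 : 0 <= k%:R * S + 2 * C * l%:R + (k * l)%:R * m.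
  by rewrite addr_ge0// mulr_ge0.
apply: (limn_einf_ge (N := (2 * (k + l + 2))%N)) => n nkl.
apply: (le_trans _ (eps_tot_ge_window k0 l0 _ nkl (x := s * ((Num.sqrt (pi *+ 2))^-1 *
  expR (- ((k%:R * S + 2 * C * l%:R + (k * l)%:R * m + s) / s + 1) ^+ 2 / 2))) _)).
- rewrite lee_fin.
  exact: (window_constant S0 C0 sigma0 N1 th0 erefl hM thsq Nmin erefl).
- by rewrite mulr_ge0 ?(ltW s0)// mulr_ge0 ?expR_ge0// invr_ge0 sqrtr_ge0.
- move=> p t0; apply: le_trans (window_cost P C p t0 k l s0 iidZ.1 ctrl).
  rewrite EFinM; apply: lee_wpmul2l; first by rewrite lee_fin ltW.
  exact: (window_sum_lower_tail p t0 sigma0 iidZ k0 l0 th0 erefl).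
Qed.
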